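(* Consider the variant of the edge-distinguishing game on the path $P_6$ in which the available color set is $[\lambda(P_6)+1]=\{1,2,3,4\}$ instead of $[\lambda(P_6)]$. In this game Player 2 has a winning strategy.
   Context: $P_6$ is the path on 6 vertices; $\lambda(P_6)=3$. For a $k$-coloring $c:V(G)\to\{1,\dots,k\}$ the induced edge coloring is $c'(\{u,v\})=\{c(u),c(v)\}$ (a multiset); $c$ is edge-distinguishing if $c'$ is injective, and $\lambda(G)$ is the least $k$ admitting such a coloring. A partial coloring on $U\subseteq V(G)$ has partial induced edge coloring on $G[U]$. The game with color set $[k]$: two players, Player 1 first, alternately color an uncolored vertex with a color from $[k]$; a move is legal iff afterwards the partial induced edge coloring of the colored vertices is injective. The player making the last legal move wins. A winning strategy guarantees a win regardless of the opponent's play. *)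

(* Defs.v *)
From HB Require Import structures.
From mathcomp Require Import all_boot finmap multiset.

Set Implicit Arguments.
Unset Strict Implicit.
Unset Printing Implicit Defensive.

Local Open Scope mset_scope.

Record sgraph := SGraph {
  vertex :> finType;
  adj : rel vertex;
  adj_sym : symmetric adj;
  adj_irr : irreflexive adj
}.

Definition edges (G : sgraph) : {set {set G}} :=
  [set [set uv.1; uv.2] | uv : G * G & adj uv.1 uv.2].

(* The edge set of the induced subgraph G[U]. *)
Definition edges_in (G : sgraph) (U : {set G}) : {set {set G}} :=
  [set e in edges G | e \subset U].

(* The induced edge coloring c'({u,v}) = {c(u), c(v)}, a multiset of colors. *)
Definition edge_color (G : sgraph) (K : choiceType) (c : G -> K) (e : {set G}) :
  {mset K} := seq_mset [seq c v | v in e].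

Definition edge_distinguishing (G : sgraph) (k : nat) (c : {ffun G -> 'I_k}) :=
  [forall e1 in edges G, forall e2 in edges G,
     (edge_color c e1 == edge_color c e2) ==> (e1 == e2)].

Definition edge_distinguishable (G : sgraph) : pred nat :=
  fun k => [exists c : {ffun G -> 'I_k}, edge_distinguishing c].

Lemma edge_distinguishable_exists (G : sgraph) :
  exists k, edge_distinguishable G k.
Proof.
exists #|G|; apply/existsP; exists [ffun v => enum_rank v].
apply/'forall_implyP => e1 _; apply/'forall_implyP => e2 _; apply/implyP.
move=> /eqP/eq_seq_msetP/perm_mem e12; apply/eqP/setP => v.
have mem_c e : ([ffun v0 : G => enum_rank v0] v
                  \in [seq [ffun v0 : G => enum_rank v0] v0 | v0 in e]) = (v \in e).
  by rewrite mem_map ?mem_enum // => x y; rewrite !ffunE; apply: enum_rank_inj.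
by rewrite -!mem_c e12.
Qed.

Definition lambda (G : sgraph) : nat := ex_minn (edge_distinguishable_exists G).

Definition path_adj (n : nat) : rel 'I_n :=
  fun i j => (i.+1 == j :> nat) || (j.+1 == i :> nat).

Lemma path_adj_sym n : symmetric (@path_adj n).
Proof. by move=> i j; rewrite /path_adj orbC. Qed.

Lemma path_adj_irr n : irreflexive (@path_adj n).
Proof. by move=> i; rewrite /path_adj orbb gtn_eqF. Qed.

Definition path_graph (n : nat) : sgraph :=
  SGraph (@path_adj_sym n) (@path_adj_irr n).

(* The color set [k] is represented by 'I_k; uncolored vertices carry None. *)
Definition position (G : sgraph) (k : nat) := {ffun G -> option 'I_k}.

Definition colored (G : sgraph) (k : nat) (p : position G k) : {set G} :=
  [set v | p v != None].

(* On the edges of G[colored p] only colors of the form Some a occur, so the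
   multisets over option 'I_k compare exactly as multisets over 'I_k. *)
Definition partial_distinguishing (G : sgraph) (k : nat) (p : position G k) :=
  [forall e1 in edges_in (colored p), forall e2 in edges_in (colored p),
     (edge_color p e1 == edge_color p e2) ==> (e1 == e2)].

Definition move (G : sgraph) (k : nat) : Type := (G * 'I_k)%type.

Definition make_move (G : sgraph) (k : nat) (p : position G k) (m : move G k) :
  position G k := [ffun v => if v == m.1 then Some m.2 else p v].

Definition legal (G : sgraph) (k : nat) (p : position G k) (m : move G k) : bool :=
  (m.1 \notin colored p) && partial_distinguishing (make_move p m).

(* A play is recorded as its sequence of moves, the earliest one first. *)
Definition position_after (G : sgraph) (k : nat) (s : seq (move G k)) :
  position G k := foldl (@make_move G k) [ffun=> None] s.

Variant player := Player1 | Player2.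

Definition to_move (G : sgraph) (k : nat) (s : seq (move G k)) : player :=
  if odd (size s) then Player2 else Player1.

Definition finished (G : sgraph) (k : nat) (s : seq (move G k)) : Prop :=
  forall m : move G k, ~ legal (position_after s) m.

Definition wins (G : sgraph) (k : nat) (w : player) (s : seq (move G k)) : Prop :=
  finished s /\ exists s' m, s = rcons s' m /\ to_move s' = w.

Definition strategy (G : sgraph) (k : nat) : Type :=
  seq (move G k) -> option (move G k).

(* The plays made of legal moves in which player w follows sigma and the
   opponent moves arbitrarily. *)
Inductive play_against (G : sgraph) (k : nat) (w : player)
    (sigma : strategy G k) : seq (move G k) -> Prop :=
| play_start : play_against w sigma [::]
| play_move s m :
    play_against w sigma s -> legal (position_after s) m ->
    (to_move s = w -> sigma s = Some m) ->
    play_against w sigma (rcons s m).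

(* The second clause keeps a strategy from winning vacuously by proposing no
   move, or an illegal one. Every play has at most #|G| moves, so it extends
   to a finished one. *)
Definition winning_strategy (G : sgraph) (k : nat) (w : player)
    (sigma : strategy G k) : Prop :=
  forall s, play_against w sigma s ->
    (finished s -> wins w s) /\
    (~ finished s -> to_move s = w ->
       exists m, sigma s = Some m /\ legal (position_after s) m).

Definition has_winning_strategy (G : sgraph) (k : nat) (w : player) : Prop :=
  exists sigma : strategy G k, winning_strategy w sigma.

(* Main.v *)
Require Import Defs.
From mathcomp Require Import all_boot finmap multiset.

(** Positions on a path are encoded as lists of optional numbers, on which the
    legality of a move is a computable test. A game of at most [2 * n] moves is
    decided by expanding [n] rounds, each consisting of an arbitrary move of
    Player 1 and a suitable reply of Player 2, so the claim reduces to evaluating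
    this expansion for three rounds on the uncolored path. *)

Set Implicit Arguments.
Unset Strict Implicit.
Unset Printing Implicit Defensive.

(** * Winning as the second player by always having a reply, on an arbitrary graph *)

Section SecondPlayer.

Variables (G : sgraph) (k : nat).
Implicit Types (p : position G k) (s : seq (move G k)).

(** Player 1 is to move at [p], and [n] bounds the number of rounds left. When it reaches zero,
    Player 1 must already be stuck, so running out of rounds never counts as a win. *)
Fixpoint second_wins n p : bool :=
  [forall m : G * 'I_k, legal p m ==>
    if n is n'.+1 then
      [exists m' : G * 'I_k, legal (make_move p m) m' &&
                             second_wins n' (make_move (make_move p m) m')]
    else false].

(** Intended for [s] of odd length: [(size s)./2.+1] rounds are then complete once the reply [m] is
    made. *)
Definition good_reply n s (m : G * 'I_k) : bool :=
  legal (position_after s) m &&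
  second_wins (n - (size s)./2.+1) (make_move (position_after s) m).

Definition reply_strategy n : strategy G k :=
  fun s => [pick m : G * 'I_k | good_reply n s m].

Lemma position_after_rcons s m :
  position_after (rcons s m) = make_move (position_after s) m.
Proof. by rewrite /position_after foldl_rcons. Qed.

(** The invariant of a play, by induction on its moves. A move of Player 1 uses up the universal
    quantifier in [second_wins] and produces a reply; the move of Player 2 is the one picked, hence
    a good one. *)
Lemma play_reply_strategy n s :
  second_wins n [ffun=> None] -> play_against Player2 (reply_strategy n) s ->
  if odd (size s) then exists m, good_reply n s m
  else second_wins (n - (size s)./2) (position_after s).
Proof.
move=> win0; elim=> [|{}s m _ IHs legm sigm]; first by rewrite subn0.
rewrite size_rcons /=; move: IHs sigm; rewrite /to_move.
case: ifP => odd_s /= IHs sigm; last first.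
  move: IHs; rewrite /good_reply size_rcons position_after_rcons /= uphalf_half odd_s.
  (* With no rounds left, the legal move [m] contradicts [second_wins]. *)
  rewrite add0n subnS; case: (n - _) => [|n'] /= /forallP/(_ m); rewrite legm //=.
  by move=> /existsP[m' m'P]; exists m'.
rewrite uphalf_half odd_s add1n position_after_rcons.
move: (sigm erefl); rewrite /reply_strategy.
by case: pickP => // m1 /andP[_ win] [<-].
Qed.

(** A finished play cannot have odd length, since a good reply would still be legal. So its length
    is even, and its last move, if any, is by Player 2; the opening move [m0] shows that the empty
    play is not finished. *)
Lemma second_wins_winning_strategy n (m0 : move G k) :
  legal [ffun=> None] m0 -> second_wins n [ffun=> None] ->
  has_winning_strategy G k Player2.
Proof.
move=> legm0 win0; exists (reply_strategy n) => s play.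
have := play_reply_strategy win0 play; case: ifP => odd_s.
  case=> m mP; have /andP[legm _] := mP.
  split=> [/(_ m)/(_ legm) //|_ _]; rewrite /reply_strategy.
  by case: pickP => [m' /andP[legm' _]|/(_ m)/=]; [exists m'|rewrite mP].
move=> _; split=> [fin|_]; last by rewrite /to_move odd_s.
split=> //; case/lastP: s odd_s fin {play} => [_ /(_ m0)/(_ legm0) //|s m].
rewrite size_rcons /= => /negbFE odd_s _.
by exists s, m; rewrite /to_move odd_s.
Qed.

End SecondPlayer.

(** * Edge colors as two-element multisets, for total and partial colorings *)

Lemma edge_color_pair (G : sgraph) (K : choiceType) (c : G -> K) (u v : G) :
  u != v -> edge_color c [set u; v] = seq_mset [:: c u; c v].
Proof.
move=> neq_uv; apply/eq_seq_msetP.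
rewrite (_ : [:: c u; c v] = map c [:: u; v]) //; apply: perm_map.
apply: uniq_perm; rewrite ?enum_uniq //= ?inE ?neq_uv // => x.
by rewrite mem_enum !inE.
Qed.

(** Brings $\lambda$ under the same computable test as the game. All vertices are colored, so no
    edge is dropped, and [Some] is injective, so it preserves and reflects equality of color
    multisets. *)
Lemma edge_distinguishingE (G : sgraph) k (c : {ffun G -> 'I_k}) :
  edge_distinguishing c =
  partial_distinguishing ([ffun v => Some (c v)] : position G k).
Proof.
set p : position G k := [ffun v => _].
have eT : edges_in (colored p) = edges G.
  apply/setP=> e; rewrite inE (_ : colored p = setT) ?subsetT ?andbT //.
  by apply/setP=> v; rewrite !inE ffunE.
rewrite /edge_distinguishing /partial_distinguishing eT.
apply: eq_forallb => e1; congr (_ ==> _); apply: eq_forallb => e2.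
congr (_ ==> (_ ==> _)); rewrite /edge_color.
have pE (e : {set G}) : [seq p v | v in e] = map Some [seq c v | v in e].
  by rewrite -map_comp; apply: eq_map => v; rewrite /= ffunE.
apply/eqP/eqP => /eq_seq_msetP e12; apply/eq_seq_msetP; move: e12; rewrite !pE.
  by apply: perm_map.
by apply: perm_map_inj => x y [].
Qed.

(** * Positions on a path as lists *)

Section Path.

Variable n : nat.
Let Pn := path_graph n.+1.

Lemma path_edgeP (e : {set Pn}) :
  reflect (exists2 i, i < n & e = [set inord i; inord i.+1]) (e \in edges Pn).
Proof.
apply: (iffP imsetP) => [[[u v] /=]|[i lt_in ->]].
  rewrite inE /= /path_adj => /orP[] /eqP uv ->.
    have lt_un : u < n by rewrite -ltnS uv ltn_ord.
    by exists u; rewrite // uv !inord_val.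
  have lt_vn : v < n by rewrite -ltnS uv ltn_ord.
  by exists v; rewrite // uv !inord_val setUC.
exists (inord i, inord i.+1) => //; rewrite inE /= /path_adj.
by rewrite !inordK ?eqxx // ltnS ltnW.
Qed.

Definition full (e : option nat * option nat) := isSome e.1 && isSome e.2.

Definition clash (e f : option nat * option nat) :=
  [&& full e, full f & perm_eq [:: e.1; e.2] [:: f.1; f.2]].

(** The zipped list enumerates the edges of the path from left to right; [pairwise] compares each
    only with later ones, so never with itself. *)
Definition no_clash (t : seq (option nat)) :=
  pairwise (fun e f => ~~ clash e f) (zip t (behead t)).

Definition code k (p : position Pn k) : seq (option nat) :=
  mkseq (fun i => omap val (p (inord i))) n.+1.

Lemma nth_code k (p : position Pn k) i :
  i < n.+1 -> nth None (code p) i = omap val (p (inord i)).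
Proof. by move=> lt_in; rewrite nth_mkseq. Qed.

Lemma size_code_edges k (p : position Pn k) :
  size (zip (code p) (behead (code p))) = n.
Proof. by rewrite size_zip size_behead size_mkseq; apply/minn_idPr. Qed.

Lemma nth_code_edges k (p : position Pn k) i :
  i < n ->
  nth (None, None) (zip (code p) (behead (code p))) i =
  (omap val (p (inord i)), omap val (p (inord i.+1))).
Proof.
move=> lt_in; rewrite nth_zip_cond size_code_edges lt_in nth_behead.
by rewrite !nth_code // ltnS ltnW.
Qed.

(** Each of [i] and [j] lies in the edge starting at the other; if they differed, each would be the
    successor of the other. *)
Lemma path_edge_inj i j :
  i < n -> j < n -> [set inord i; inord i.+1] = [set inord j; inord j.+1] :> {set Pn} ->
  i = j.
Proof.
move=> lt_in lt_jn eij.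
have mem a b : a < n.+1 -> b < n ->
    ((inord a : Pn) \in [set inord b; inord b.+1]) = (a == b) || (a == b.+1).
  by move=> an bn; rewrite !inE -!val_eqE /= !inordK // ltnS ltnW.
have /esym := mem i j (ltnW lt_in : i < n.+1) lt_jn.
have := mem j i (ltnW lt_jn : j < n.+1) lt_in.
(* Exchanging the two equal sets places each vertex in its own edge, which makes both memberships
   true. *)
rewrite eij -{2}eij !inE !eqxx /= => /esym/orP[/eqP //|/eqP ->].
by case/orP=> /eqP => [//|/eqP]; rewrite ltn_eqF.
Qed.

(** The edge [E i] is the entry [i] of the zipped list, and [omap val] is injective, so a clash of
    entries is exactly an equality of colors of fully colored edges. Symmetry reduces distinct edges
    to the case [i < j]. *)
Lemma partial_distinguishing_code k (p : position Pn k) :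
  partial_distinguishing p = no_clash (code p).
Proof.
pose E i : {set Pn} := [set inord i; inord i.+1].
have neqE i : i < n -> (inord i : Pn) != inord i.+1.
  by move=> lt_in; rewrite -val_eqE /= !inordK ?ltn_eqF // ltnS ltnW.
have colE i : i < n ->
    (E i \in edges_in (colored p)) = full (omap val (p (inord i)), omap val (p (inord i.+1))).
  move=> lt_in; rewrite inE (introT (path_edgeP _)) /=; last by exists i.
  rewrite subUset !sub1set !inE /full /=.
  by case: (p _) => [?|]; case: (p _) => [?|].
have clashE i j : i < n -> j < n ->
   clash (omap val (p (inord i)), omap val (p (inord i.+1)))
         (omap val (p (inord j)), omap val (p (inord j.+1))) =
   [&& E i \in edges_in (colored p), E j \in edges_in (colored p)
     & edge_color p (E i) == edge_color p (E j)].
  move=> lt_in lt_jn; rewrite !colE // /clash; do 2!congr (_ && _).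
  rewrite !edge_color_pair ?neqE //=.
  have inj : injective (omap val : option 'I_k -> option nat).
    exact: inj_omap val_inj.
  rewrite -[[:: _; _]]/(map (omap val) [:: p (inord i); p (inord i.+1)]).
  rewrite -[X in perm_eq _ X]/(map (omap val) [:: p (inord j); p (inord j.+1)]).
  apply/idP/eqP => [/(perm_map_inj inj) /eq_seq_msetP //|/eq_seq_msetP].
  exact: perm_map.
apply/idP/idP => [dist|].
  apply/(pairwiseP (None, None)) => i j; rewrite !inE size_code_edges.
  move=> lt_in lt_jn lt_ij; rewrite !nth_code_edges // clashE //.
  apply/negP => /and3P[Ei Ej eij].
  move/'forall_implyP/(_ _ Ei)/'forall_implyP/(_ _ Ej): dist; rewrite eij /=.
  by move=> /eqP/(path_edge_inj lt_in lt_jn) eq_ij; rewrite eq_ij ltnn in lt_ij.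
move/(pairwiseP (None, None)) => noc.
have noC i j : i < n -> j < n -> i < j ->
   E i \in edges_in (colored p) -> E j \in edges_in (colored p) ->
   edge_color p (E i) != edge_color p (E j).
  move=> lt_in lt_jn lt_ij Ei Ej; have := noc i j.
  by rewrite !inE size_code_edges !nth_code_edges // clashE // Ei Ej; apply.
apply/'forall_implyP => e1 e1P; apply/'forall_implyP => e2 e2P; apply/implyP.
have [i lt_in e1E] : exists2 i, i < n & e1 = E i.
  by apply/path_edgeP; case/setIdP: e1P.
have [j lt_jn e2E] : exists2 j, j < n & e2 = E j.
  by apply/path_edgeP; case/setIdP: e2P.
rewrite {}e1E {}e2E in e1P e2P *.
case: (ltngtP i j) => [ij|ji|->]; rewrite ?eqxx ?implybT //.
  by rewrite (negPf (noC _ _ lt_in lt_jn ij e1P e2P)).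
by rewrite eq_sym (negPf (noC _ _ lt_jn lt_in ji e2P e1P)).
Qed.

(** Because of the default [None], an index past the end would look uncolored; the search below
    draws indices from [iota 0 n.+1] only, the range of a code. *)
Definition code_legal (t : seq (option nat)) (i c : nat) :=
  (nth None t i == None) && no_clash (set_nth None t i (Some c)).

Fixpoint code_second_wins k r (t : seq (option nat)) : bool :=
  all (fun i => all (fun c =>
    if code_legal t i c then
      let t1 := set_nth None t i (Some c) in
      if r is r'.+1 then
        has (fun j => has (fun d =>
          if code_legal t1 j d then code_second_wins k r' (set_nth None t1 j (Some d))
          else false) (iota 0 k)) (iota 0 n.+1)
      else false
    else true) (iota 0 k)) (iota 0 n.+1).

Lemma code_make_move k (p : position Pn k) (v : Pn) (c : 'I_k) :
  code (make_move p (v, c)) = set_nth None (code p) v (Some (val c)).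
Proof.
have szS : size (set_nth None (code p) v (Some (val c))) = n.+1.
  by rewrite size_set_nth size_mkseq; apply/maxn_idPr.
apply: (@eq_from_nth _ None); first by rewrite szS size_mkseq.
move=> i; rewrite size_mkseq => lt_in.
rewrite nth_code // nth_set_nth /= ffunE /= nth_code //.
by rewrite -val_eqE /= inordK //; case: eqP.
Qed.

Lemma legal_code k (p : position Pn k) (v : Pn) (c : 'I_k) :
  legal p (v, c) = code_legal (code p) v (val c).
Proof.
rewrite /legal /code_legal partial_distinguishing_code code_make_move /=.
by rewrite nth_code // inord_val inE negbK; case: (p v).
Qed.

Lemma second_wins_code k r (p : position Pn k) :
  code_second_wins k r (code p) -> second_wins r p.
Proof.
have memI a b : a < b -> a \in iota 0 b by rewrite mem_iota.
elim: r p => [|r IHr] p win; apply/forallP => -[v c]; apply/implyP;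
  rewrite legal_code => legvc;
  move: win => /allP/(_ _ (memI _ _ (ltn_ord v)))/allP;
  move=> /(_ _ (memI _ _ (ltn_ord c))); rewrite legvc //.
move=> /hasP[i]; rewrite mem_iota add0n /= => lt_in /hasP[d].
rewrite mem_iota add0n /= => lt_dk; case: ifP => // legd win.
apply/existsP; exists (Ordinal lt_in : Pn, Ordinal lt_dk).
by rewrite legal_code code_make_move legd; apply: IHr; rewrite !code_make_move.
Qed.

End Path.

(** * The value of $\lambda(P_6)$ and the game with one extra color *)

Lemma code_start n k : code ([ffun=> None] : position (path_graph n.+1) k) = nseq n.+1 None.
Proof.
apply: (@eq_from_nth _ None); rewrite size_mkseq ?size_nseq // => i lt_in.
by rewrite nth_code // ffunE nth_nseq lt_in.
Qed.

Lemma edge_distinguishing_path n k (c : {ffun path_graph n.+1 -> 'I_k}) :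
  edge_distinguishing c = no_clash (mkseq (fun i => Some (val (c (inord i)))) n.+1).
Proof.
rewrite edge_distinguishingE partial_distinguishing_code; congr no_clash.
by apply: eq_map => i; rewrite ffunE.
Qed.

Lemma lambda_path6 : lambda (path_graph 6) = 3.
Proof.
rewrite /lambda; case: ex_minnP => k /existsP[c]; rewrite edge_distinguishing_path => cP min_k.
apply/eqP; rewrite eqn_leq; apply/andP; split.
  apply: min_k; apply/existsP.
  (* The five edges get the distinct colors 00, 01, 11, 12, 22. *)
  exists [ffun i : path_graph 6 => inord (nth 0 [:: 0; 0; 1; 1; 2; 2] i)].
  by rewrite edge_distinguishing_path /mkseq /= !ffunE /= !inordK.
rewrite ltnNge; apply/negP => le_k2.
(* Two colors give only three multisets for five edges; here the 64 binary words are simply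
   checked. *)
suff bin a0 a1 a2 a3 a4 a5 : a0 < 2 -> a1 < 2 -> a2 < 2 -> a3 < 2 -> a4 < 2 -> a5 < 2 ->
    ~~ no_clash [:: Some a0; Some a1; Some a2; Some a3; Some a4; Some a5].
  by move: cP; apply/negP; apply: bin; apply: leq_trans (ltn_ord _) le_k2.
by case: a0 => [|[|//]]; case: a1 => [|[|//]]; case: a2 => [|[|//]];
   case: a3 => [|[|//]]; case: a4 => [|[|//]]; case: a5 => [|[|//]].
Qed.

Lemma path6_code_second_wins : code_second_wins 5 4 3 (nseq 6 None).
Proof.
(* [vm_compute] would evaluate [&&] and [||] eagerly and explore the whole game
   tree; [lazy] stops at the first successful reply. *)
by lazy.
Qed.

Theorem theorem3p12 :
  lambda (path_graph 6) = 3 /\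
  has_winning_strategy (path_graph 6) (lambda (path_graph 6) + 1) Player2.
Proof.
rewrite lambda_path6; split=> //.
(* Six vertices allow at most three rounds. The opening move colors an end vertex, which completes
   no edge. *)
apply: (@second_wins_winning_strategy (path_graph 6) 4 3 (@ord0 5, @ord0 3)).
  by rewrite legal_code code_start.
by apply: second_wins_code; rewrite code_start path6_code_second_wins.
Qed.
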